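(* Let $n$ be a positive multiple of $4$, $n_0=n/4$, $c_e\ge0$, $0<c_l\le c_L$. Let $x^*\in\mathcal C^n$ and $f\in\mathcal{BL}[c_l,c_L,c_e]$, and suppose the observed random symmetric matrix $A$ satisfies $A_{ii}=0$ and $A_{ij}=f(x_i^*,x_j^* )+E_{ij}$ for $i<j$, where the centered independent variables $(E_{ij})_{i<j}$ satisfy the subGaussian(1) condition. Let $S\subset\{1,\dots,n\}$ be of cardinality $n_0$, and let $\hat x^{(1)}_S$ be any estimator based on $A_{SS}=[A_{ij}]_{i,j\in S}$ (i.e. a measurable function of $A_{SS}$) taking values in $\Pi_{n_0}$. For $i\in\bar S=\{1,\dots,n\}\setminus S$ let $$\hat x^{(2)}_i\in\arg\min_{z\in\mathcal C_{n_0}}\ \sum_{j\in S}A_{ij}\,d(z,\hat x^{(1)}_j).$$ Then there exists a constant $C_{lLe}$ depending only on $c_l,c_L,c_e$ such that, conditionally on $A_{SS}$, and for all $Q\in\mathcal O$, with probability at least $1-1/n^2$, $$d_\infty(\hat x^{(2)}_{\bar S},Qx^*_{\bar S})\le C_{lLe}\left(d_\infty(x^*_S,\Pi_{n_0})+\frac{d_1(\hat x^{(1)}_S,Qx^*_S)}{n}+\sqrt{\frac{\log n}{n}}\right).$$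
   Context: $\mathcal C$ is the unit circle in $\mathbb R^2$, identified with unit complex numbers; $x\in\mathcal C$ has argument $\underline x\in[0,2\pi)$; $d(x,y)=|\underline x-\underline y|\wedge(2\pi-|\underline x-\underline y|)$ is the geodesic distance. For tuples $x,y$ of points of $\mathcal C$ indexed by the same set, $d_\infty(x,y)=\max_i d(x_i,y_i)$ and $d_1(x,y)=\sum_id(x_i,y_i)$; $x_S=(x_i)_{i\in S}$. $\mathcal C_k=\{e^{\iota 2\pi j/k}:0\le j\le k-1\}$; $\Pi_k$ is the set of $k$-tuples (indexed by a set of cardinality $k$) that list each element of $\mathcal C_k$ exactly once; $d_\infty(x,\Pi_k)=\min_{y\in\Pi_k}d_\infty(x,y)$. $\mathcal O$ is the orthogonal group of $\mathbb R^2$, acting coordinatewise on tuples. $\mathcal{BL}[c_l,c_L,c_e]$ is the set of symmetric functions $f:\mathcal C\times\mathcal C\to[0,1]$ such that for all $x,y,y'\in\mathcal C$, with $\varepsilon_n=c_e\sqrt{\log(n)/n}$: $|f(x,y)-f(x,y')|\le c_Ld(y,y')+\varepsilon_n$; and $f(x,y')-f(x,y)\ge c_l(d(x,y)-d(x,y'))-\varepsilon_n$ whenever $d(x,y)\ge d(x,y')$. SubGaussian(1) condition: for every $B\in\mathbb R^{n\times n}$ and $t\ge0$, $\mathbb P\big[\sum_{i<j}B_{ij}E_{ij}>t\sqrt{\sum_{i<j}B_{ij}^2}\big]\le e^{-t^2/2}$. *)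

(* Defs.v *)
From HB Require Import structures.
From mathcomp Require Import all_boot all_order all_algebra.
From mathcomp Require Import all_classical all_reals all_analysis.
From mathcomp Require Import ring lra.
Set Implicit Arguments.
Unset Strict Implicit.
Unset Printing Implicit Defensive.
Import Order.TTheory GRing.Theory Num.Theory.
Import numFieldNormedType.Exports measurable_realfun.
Local Open Scope classical_set_scope.
Local Open Scope ring_scope.

Section Circle.
Context {R : realType}.

(* x + iy is the column vector (x, y)^T. *)
Definition circle := {v : 'cV[R]_2 | v 0 0 ^+ 2 + v 1 0 ^+ 2 == 1}.

Definition cis_vec (t : R) : 'cV[R]_2 :=
  \col_(k < 2) (if k == 0 then cos t else sin t).

Lemma cis_vec_circle t : cis_vec t 0 0 ^+ 2 + cis_vec t 1 0 ^+ 2 == 1.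
Proof. by rewrite !mxE /= cos2Dsin2. Qed.

Definition cis (t : R) : circle := exist _ (cis_vec t) (cis_vec_circle t).

Definition arg (x : circle) : R :=
  let v := val x in
  if 0 <= v 1 0 then acos (v 0 0) else pi *+ 2 - acos (v 0 0).

Lemma arg_ge0_lt2pi (x : circle) : 0 <= arg x < pi *+ 2.
Proof.
case: x => v hv; have /eqP v1 := hv; rewrite /arg /=.
have hc : -1 <= v 0 0 <= 1.
  by rewrite -ler_norml -(@expr_le1 _ 2)// -normrX ger0_norm ?sqr_ge0// -v1
    lerDl sqr_ge0.
have := acos_ge0 hc; have := acos_lepi hc; have := @pi_gt0 R => p0 ap a0.
case: ifPn => [_|]; first by rewrite a0 /= mulr2n; lra.
rewrite -ltNge => v10; apply/andP; split; first by rewrite mulr2n; lra.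
suff : 0 < acos (v 0 0) by lra.
rewrite lt0r a0 andbT; apply/eqP => /(congr1 cos).
rewrite acosK ?in_itv//= cos0 => v0.
have /eqP : v 1 0 ^+ 2 = 0 by move: v1; rewrite v0 expr1n; lra.
by rewrite sqrf_eq0 lt_eqF.
Qed.

Lemma cis_arg (x : circle) : cis (arg x) = x.
Proof.
case: x => v hv; have /eqP v1 := hv; apply: val_inj => /=.
have hc : -1 <= v 0 0 <= 1.
  by rewrite -ler_norml -(@expr_le1 _ 2)// -normrX ger0_norm ?sqr_ge0// -v1
    lerDl sqr_ge0.
have sE : 1 - v 0 0 ^+ 2 = v 1 0 ^+ 2 by rewrite -v1; ring.
apply/matrixP => k j; rewrite (ord1 j) mxE /arg /=.
have [->|->] : k = 0 \/ k = 1.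
- case: k => -[|[|//]] hk; [left|right]; exact: val_inj.
- rewrite eqxx; case: ifPn => _; first by rewrite acosK// in_itv.
  by rewrite addrC cosD2pi cosN acosK// in_itv.
- rewrite /=; case: ifPn => h.
    by rewrite sin_acos// sE sqrtr_sqr ger0_norm.
  rewrite addrC sinD2pi sinN sin_acos// sE sqrtr_sqr ler0_norm ?opprK//.
  by rewrite ltW// ltNge.
Qed.

Definition dist (x y : circle) : R :=
  Num.min `|arg x - arg y| (pi *+ 2 - `|arg x - arg y|).

Definition orthogonal2 := {Q : 'M[R]_2 | Q^T *m Q == 1%:M}.

Lemma orthogonal2_circle (Q : orthogonal2) (x : circle) :
  (val Q *m val x) 0 0 ^+ 2 + (val Q *m val x) 1 0 ^+ 2 == 1.
Proof.
case: Q x => Q /= /eqP hQ [v /= /eqP hv].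
have nE (w : 'cV[R]_2) : w 0 0 ^+ 2 + w 1 0 ^+ 2 = (w^T *m w) 0 0.
  by rewrite !mxE big_ord_recl big_ord1 !mxE !expr2; congr (_ + w _ 0 * w _ 0);
    apply: val_inj.
by rewrite nE trmx_mul mulmxA -(mulmxA v^T) hQ mulmx1 -nE hv.
Qed.

Definition orthogonal2_act (Q : orthogonal2) (x : circle) : circle :=
  exist _ (val Q *m val x) (orthogonal2_circle Q x).

Definition C_ (k : nat) : set circle :=
  [set cis (pi *+ 2 * j%:R / k%:R) | j in [set j | (j < k)%N]].

Definition BL (cl cL ce : R) (n : nat) (f : circle -> circle -> R) : Prop :=
  let eps := ce * Num.sqrt (ln n%:R / n%:R) in
  [/\ forall x y, 0 <= f x y <= 1,
      forall x y, f x y = f y x,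
      forall x y y', `|f x y - f x y'| <= cL * dist y y' + eps
    & forall x y y', dist x y' <= dist x y ->
        cl * (dist x y - dist x y') - eps <= f x y' - f x y].

Section Tuples.
Variable I : finType.

Definition Pi_ (k : nat) : set (I -> circle) :=
  [set y | (forall i, C_ k (y i)) /\
           (forall z, C_ k z -> exists! i, y i = z)].

Definition d_inf (x y : I -> circle) : R :=
  \big[Num.max/0]_(i : I) dist (x i) (y i).

Definition d_1 (x y : I -> circle) : R := \sum_(i : I) dist (x i) (y i).

(* The infimum is a minimum: Pi_ k is finite, and nonempty when #|I| = k. *)
Definition d_inf_Pi (x : I -> circle) (k : nat) : R :=
  inf [set d_inf x y | y in Pi_ k].

End Tuples.

End Circle.

Arguments circle : clear implicits.
Arguments orthogonal2 : clear implicits.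
Arguments Pi_ {R} I k.

Notation idx S := {i | i \in S}.

Definition coords (T : Type) (n : nat) (S : {set 'I_n}) (x : 'I_n -> T) :
  idx S -> T := fun i => x (val i).

Definition submatrix (R : Type) (n : nat) (S : {set 'I_n}) (A : 'M[R]_n) :
  idx S -> idx S -> R := fun i j => A (val i) (val j).

Arguments coords {T n} S x i.
Arguments submatrix {R n} S A i j.

Definition argmin (R : realType) (T : Type) (D : set T) (g : T -> R) : set T :=
  [set z | D z /\ forall z', D z' -> g z <= g z'].

Section Probability.
Context {R : realType}.

(* Borel sigma-algebra of the square matrices indexed by I. *)
Definition matrix_sigma (I : Type) : set (set (I -> I -> R)) :=
  <<s \bigcup_(ij in [set: I * I])
        preimage_set_system setT (fun M : I -> I -> R => M ij.1 ij.2)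
          (@measurable _ R) >>.

(* Measurability with respect to a sigma-algebra F that need not be the
   canonical one of its carrier. *)
Definition F_measurable (T : Type) (F : set (set T)) (X : T -> R) : Prop :=
  forall B : set R, measurable B -> F (X @^-1` B).

Definition F_measurable_circle (T : Type) (F : set (set T))
    (X : T -> circle R) : Prop :=
  forall k : 'I_2, F_measurable F (fun t => val (X t) k 0).

Context (d : measure_display) (Omega : measurableType d)
  (P : probability Omega R).

(* sigma-algebra on Omega generated by a random matrix M. *)
Definition sigma_of (I : Type) (M : Omega -> I -> I -> R) : set (set Omega) :=
  preimage_set_system setT M (@matrix_sigma I).

(* p is a version of the conditional probability P(E | F). *)
Definition is_cond_prob (F : set (set Omega)) (E : set Omega)
    (p : Omega -> R) : Prop :=
  F_measurable F p /\
  forall G, F G -> (\int[P]_(w in G) (p w)%:E = P (E `&` G))%E.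

Definition cond_prob (F : set (set Omega)) (E : set Omega) : Omega -> R :=
  xget (cst 0) [set p | is_cond_prob F E p].

Definition mutual_independence (I : finType) (X : I -> Omega -> R) : Prop :=
  forall (J : {set I}) (B : I -> set R), (forall i, measurable (B i)) ->
    (P (\bigcap_(i in [set i | i \in J]) (X i @^-1` B i))
     = \prod_(i in J) P (X i @^-1` B i))%E.

Definition centered (X : {RV P >-> R}) : Prop :=
  P.-integrable setT (EFin \o X) /\ ('E_P[X] = 0)%E.

Definition subGaussian1 (n : nat) (E : 'I_n -> 'I_n -> Omega -> R) : Prop :=
  forall (B : 'M[R]_n) (t : R), 0 <= t ->
    (P [set w | (t * Num.sqrt (\sum_(i < n) \sum_(j < n | (i < j)%N) B i j ^+ 2)
                < \sum_(i < n) \sum_(j < n | (i < j)%N) B i j * E i j w)%R]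
     <= (expR (- t ^+ 2 / 2))%:E)%E.

End Probability.

Arguments matrix_sigma R I : clear implicits.

Section CondProbExists.
Context {R : realType} (d : measure_display) (Omega : measurableType d)
  (P : probability Omega R).

Lemma sigma_of_sigma_algebra (I : Type) (M : Omega -> I -> I -> R) :
  sigma_algebra setT (sigma_of M).
Proof. by apply: sigma_algebra_preimage; exact: smallest_sigma_algebra. Qed.

Variables (F : set (set Omega)) (E : set Omega).
Hypotheses (sF : sigma_algebra setT F) (Fm : F `<=` measurable)
  (mE : measurable E).

Let U := g_sigma_algebraType F.

Let mU (B : set U) : measurable B = F B.
Proof. by rewrite -[in RHS](sigma_algebra_id sF). Qed.

Let phi : Omega -> U := id.

Let mphi : measurable_fun setT phi.
Proof. by move=> _ B; rewrite mU setTI => /Fm. Qed.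

Let push (m : {measure set Omega -> \bar R}) : {measure set U -> \bar R} :=
  measure_function_pushforward__canonical__measure_function_Measure m mphi.

Let mu0 := push P.

Let nu0 := push (mrestr P mE).

Let mu0_fin : fin_num_fun mu0.
Proof. by move=> B mB; apply: fin_num_measure; apply: Fm; rewrite -mU. Qed.

Let nu0_fin : fin_num_fun nu0.
Proof.
move=> B; rewrite mU => FB; apply: fin_num_measure.
exact: Fm.
Qed.

Let mu0' : {finite_measure set U -> \bar R} :=
  HB.pack (Measure.sort mu0) (Measure.class mu0) (Measure_isFinite.Build _ _ _ mu0 mu0_fin).

Let nu0' : {finite_measure set U -> \bar R} :=
  HB.pack (Measure.sort nu0) (Measure.class nu0) (Measure_isFinite.Build _ _ _ nu0 nu0_fin).

Lemma is_cond_prob_exists : exists p, is_cond_prob P F E p.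
Proof.
have dom : nu0' `<< mu0'.
  apply/null_content_dominatesP => B; rewrite mU => FB /= B0.
  apply/eqP; rewrite -measure_le0 -B0.
  by apply: le_measure; rewrite ?inE//; [apply: measurableI => //|];
    exact: Fm.
have [p [p0 pfin intp pE]] := radon_nikodym_sigma_finite dom.
have pK w : (fine (p w))%:E = p w by rewrite fineK.
exists (fine \o p); split.
  move=> B mB; rewrite -mU -[X in measurable X]setTI.
  have mp : measurable_fun [set: U] (p : U -> \bar R) by exact: measurable_int intp.
  have mf : measurable_fun [set: U] (fine \o p : U -> R).
    by apply: measurableT_comp => //; exact: measurable_fine.
  exact: mf.
move=> G FG.
have mG : measurable (G : set U) by rewrite mU.
transitivity (\int[P]_(w in phi @^-1` G) (p \o phi) w)%E.
  by apply: eq_integral => w _ /=; rewrite pK.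
rewrite -(ge0_integral_pushforward mphi P mG) //.
- by rewrite setIC; apply/esym; exact: pE.
- by apply: measurable_funS (measurable_int _ intp).
Qed.

(* cond_prob never falls back on the default value of xget. *)
Lemma cond_probP : is_cond_prob P F E (cond_prob P F E).
Proof.
have [p hp] := is_cond_prob_exists.
by rewrite /cond_prob; case: xgetP => [q -> //|/(_ p)].
Qed.

End CondProbExists.

(* Main.v *)
Require Import Defs.
From HB Require Import structures.
From mathcomp Require Import all_boot all_order all_algebra.
From mathcomp Require Import all_classical all_reals all_analysis.
From mathcomp Require Import zify ring lra.
Set Implicit Arguments.
Unset Strict Implicit.
Import Order.TTheory GRing.Theory Num.Theory.
Import numFieldNormedType.Exports.
Import measurable_realfun.
Local Open Scope classical_set_scope.
Local Open Scope ring_scope.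

(** Fix i outside S, let a be a vertex of C_{n0} close to Q x*_i and b the index
of the estimate of x*_i. Optimality of b says that the sum over j in S of
A_ij (d(z_b, xhat_j) - d(z_a, xhat_j)) is nonpositive. Since xhat lists every
vertex of the regular n0-gon exactly once, the reflection exchanging z_a and z_b
preserves the family xhat and flips the sign of the weights; pairing each vertex
with its mirror image and using the bi-Lipschitz lower bound, the signal is at
least of order n d(z_a, z_b)^2. All perturbations carry a factor d(z_a, z_b),
because each weight is bounded by it: replacing x*_j by the estimate costs
d(z_a, z_b) d_1, and the noise costs d(z_a, z_b) sqrt(n log n). Dividing by
n d(z_a, z_b) gives the bound.

Conditionally on A_SS the weights are frozen, as xhat takes finitely many values,
and the entries E_ij with i outside S remain independent of A_SS; the
subGaussian tail and a union bound over (i, b) control the noise on every event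
of sigma(A_SS), which is what an almost sure lower bound on the conditional
probability requires. *)

(** * Regular polygons on the circle *)

Section CircleGeometry.
Context {R : realType}.
Implicit Types (x y z : circle R) (s t : R).

Lemma acos_cos_lt2pi t : 0 <= t < pi *+ 2 ->
  acos (cos t) = Num.min t (pi *+ 2 - t).
Proof.
move=> /andP[t0 tpi]; have := @pi_gt0 R; rewrite mulr2n in tpi *.
move=> p0; have [tp|tp] := lerP t (pi + pi - t).
  by rewrite cosK// in_itv /= t0/=; lra.
rewrite -cosN -cosD2pi mulr2n addrC cosK// in_itv /=; lra.
Qed.

Lemma acos_cos_le2pi t : 0 <= t <= pi *+ 2 ->
  acos (cos t) = Num.min t (pi *+ 2 - t).
Proof.
move=> /andP[t0]; rewrite le_eqVlt => /predU1P[->|tpi]; last first.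
  by rewrite acos_cos_lt2pi// t0.
rewrite subrr min_r; last by rewrite mulrn_wge0 ?pi_ge0.
have := cosD2pi (0 : R); rewrite add0r => ->.
by rewrite cos0 acos1.
Qed.

(** The geodesic distance is the angle between two unit vectors, hence a function of their inner
    product; invariance under orthogonal maps follows from this form. *)
Lemma distE x y :
  dist x y = acos (val x 0 0 * val y 0 0 + val x 1 0 * val y 1 0).
Proof.
have /andP[x0 x2] := arg_ge0_lt2pi x; have /andP[y0 y2] := arg_ge0_lt2pi y.
rewrite /dist -[in RHS](cis_arg x) -[in RHS](cis_arg y) /= !mxE /= -cosB.
by rewrite -cos_norm acos_cos_lt2pi// normr_ge0 /= ltr_norml; lra.
Qed.

Lemma dist_cis s t : dist (cis s) (cis t) = acos (cos (s - t)).
Proof. by rewrite distE /= !mxE /= cosB. Qed.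

Lemma distC x y : dist x y = dist y x.
Proof. by rewrite /dist distrC. Qed.

Lemma dist_ge0 x y : 0 <= dist x y.
Proof.
have /andP[x0 x2] := arg_ge0_lt2pi x; have /andP[y0 y2] := arg_ge0_lt2pi y.
by rewrite /dist le_min normr_ge0 subr_ge0 ler_norml; lra.
Qed.

Lemma dist_triangle y x z : dist x z <= dist x y + dist y z.
Proof.
have /andP[x0 x2] := arg_ge0_lt2pi x; have /andP[y0 y2] := arg_ge0_lt2pi y.
have /andP[z0 z2] := arg_ge0_lt2pi z.
(* With the arguments and [pi *+ 2] generalised, the claim is piecewise linear: each choice of
   minima and signs leaves linear arithmetic. *)
rewrite /dist; move: (arg x) (arg y) (arg z) x0 x2 y0 y2 z0 z2 => a b c.
move: (pi *+ 2) => p *.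
rewrite !minElt; do ![case: ifPn]; rewrite -?leNgt;
  case: (ler0P (a - c)); case: (ler0P (a - b)); case: (ler0P (b - c)); lra.
Qed.

Lemma dist_act (Q : orthogonal2 R) x y :
  dist (orthogonal2_act Q x) (orthogonal2_act Q y) = dist x y.
Proof.
have dotE (v w : 'cV[R]_2) :
    v 0 0 * w 0 0 + v 1 0 * w 1 0 = (v^T *m w) 0 0.
  by rewrite !mxE big_ord_recl big_ord1 !mxE; congr (_ + v _ 0 * w _ 0);
    apply: val_inj.
have /eqP QQ := valP Q; rewrite !distE !dotE /= trmx_mul mulmxA.
by rewrite -(mulmxA (val x)^T) QQ mulmx1.
Qed.

Lemma orthogonal2_inv_subproof (Q : orthogonal2 R) :
  ((val Q)^T)^T *m (val Q)^T == 1%:M.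
Proof. by have /eqP/mulmx1C QQ := valP Q; rewrite trmxK QQ. Qed.

Definition orthogonal2_inv (Q : orthogonal2 R) : orthogonal2 R :=
  exist _ (val Q)^T (orthogonal2_inv_subproof Q).

Lemma orthogonal2_invK (Q : orthogonal2 R) x :
  orthogonal2_act (orthogonal2_inv Q) (orthogonal2_act Q x) = x.
Proof.
by have /eqP QQ := valP Q; apply: val_inj => /=; rewrite mulmxA QQ mul1mx.
Qed.

End CircleGeometry.

Section RegularPolygon.
Context {R : realType} (m : nat).
Local Notation N := m.+1.
Implicit Types a b c k s : 'I_N.

Definition vertex a : circle R := cis (pi *+ 2 * a%:R / N%:R).

(** Distance from vertex 0 to vertex [a]. Distances between vertices depend only on the difference
    in the cyclic group ['I_N], so this function of one variable carries them all. *)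
Definition vertex_dist a : R := acos (cos (pi *+ 2 * a%:R / N%:R)).

Lemma cos_mod_vertex (j : nat) :
  cos (pi *+ 2 * (j %% N)%N%:R / N%:R) = cos (pi *+ 2 * j%:R / N%:R) :> R.
Proof.
rewrite [in RHS](divn_eq j N) natrD natrM mulrDr mulrDl addrC.
rewrite mulrA mulfK ?pnatr_eq0// [_ * (j %/ N)%:R]mulr_natr.
by rewrite (periodicn (@cosD2pi R)).
Qed.

Lemma distE_vertex a b : dist (vertex a) (vertex b) = vertex_dist (a - b).
Proof.
rewrite dist_cis /vertex_dist /= modnDmr cos_mod_vertex; congr acos.
rewrite natrD natrB; last exact: ltnW.
rewrite addrCA mulrDr mulrDl mulfK ?pnatr_eq0//.
rewrite [pi *+ 2 + _]addrC cosD2pi.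
by rewrite mulrBr mulrBl.
Qed.

Lemma vertex_distN a : vertex_dist (- a) = vertex_dist a.
Proof. by rewrite -[- a]sub0r -distE_vertex distC distE_vertex subr0. Qed.

Lemma vertex_distE a : vertex_dist a =
  Num.min (pi *+ 2 * a%:R / N%:R) (pi *+ 2 - pi *+ 2 * a%:R / N%:R).
Proof.
rewrite /vertex_dist acos_cos_lt2pi//.
have p2 : (0 : R) < pi *+ 2 by rewrite pmulrn_rgt0 ?pi_gt0.
rewrite divr_ge0 ?mulr_ge0 ?ler0n ?(ltW p2)//= ltr_pdivrMr ?ltr0n//.
by rewrite ltr_pM2l// ltr_nat.
Qed.

Lemma C_vertex z : C_ N z <-> exists a, z = vertex a.
Proof.
split=> [[j /= jN <-]|[a ->]]; last by exists a => //=; exact: ltn_ord.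
by exists (Ordinal jN).
Qed.

(** Rounding the argument down to a multiple of the polygon step loses at most one step. *)
Lemma vertex_near (x : circle R) : exists a, dist x (vertex a) <= pi *+ 2 / N%:R.
Proof.
have /andP[x0 x2] := arg_ge0_lt2pi x.
have p2 : (0 : R) < pi *+ 2 by rewrite pmulrn_rgt0 ?pi_gt0.
have N0 : (0 : R) < N%:R by rewrite ltr0n.
pose u := arg x / (pi *+ 2) * N%:R.
have u0 : 0 <= u by rewrite mulr_ge0 ?divr_ge0// ltW.
have [ul uu] := andP (truncn_itv u0).
have jN : (Num.truncn u < N)%N.
  rewrite -(ltr_nat R) (le_lt_trans ul)// -[ltRHS]mul1r ltr_pM2r//.
  by rewrite ltr_pdivrMr// mul1r.
exists (Ordinal jN); rewrite -{1}(cis_arg x) dist_cis /=.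
have -> : arg x - pi *+ 2 * (Num.truncn u)%:R / N%:R
    = (u - (Num.truncn u)%:R) * (pi *+ 2 / N%:R).
  rewrite mulrBl {1}/u -[arg x / _ * _ * _]mulrA [N%:R * _]mulrCA.
  rewrite divff ?gt_eqF// mulr1 divfK ?gt_eqF//.
  by rewrite mulrA [_%:R * (pi *+ 2)]mulrC.
have v0 : 0 <= u - (Num.truncn u)%:R by rewrite subr_ge0.
have v1 : u - (Num.truncn u)%:R <= 1 by rewrite lerBlDl natr1 ltW.
have q1 : pi *+ 2 / N%:R <= pi *+ 2 :> R.
  by rewrite ler_pdivrMr// ler_peMr ?ler1n// ltW.
have q0 : 0 <= pi *+ 2 / N%:R :> R by rewrite divr_ge0// ltW.
have h : (u - (Num.truncn u)%:R) * (pi *+ 2 / N%:R) <= pi *+ 2 / N%:R.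
  by rewrite ler_piMl.
rewrite acos_cos_le2pi; first by rewrite ge_min h.
by rewrite mulr_ge0//= (le_trans h).
Qed.

(** Let p be a full turn and A, S the angles of [a], [s]. If A <= p/2, then [a + s] works: its
    distance to vertex 0 is A + S or p - A - S, and p - A - 2S >= A/2 because S <= p/8. Otherwise
    [a - s] works by symmetry. *)
Lemma vertex_dist_spread a s : (8 * s <= N)%N ->
  vertex_dist a / 2 <= vertex_dist (a + s) - vertex_dist s \/
  vertex_dist a / 2 <= vertex_dist (a - s) - vertex_dist s.
Proof.
move=> sN; have p0 : (0 : R) < pi *+ 2 by rewrite pmulrn_rgt0 ?pi_gt0.
have N0 : (0 : R) < N%:R by rewrite ltr0n.
rewrite (vertex_distE a) (vertex_distE s) /vertex_dist /= modnDmr !cos_mod_vertex.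
rewrite !natrD natrB; last exact: ltnW.
have cosp := @cosD2pi R; have acosp := @acos_cos_le2pi R.
move: (pi *+ 2) p0 cosp acosp => p p0 cosp acosp.
set A := p * a%:R / N%:R; set S := p * s%:R / N%:R.
have -> : p * (a%:R + s%:R) / N%:R = A + S by rewrite mulrDr mulrDl.
have -> : p * (a%:R + (N%:R - s%:R)) / N%:R = A - S + p.
  by rewrite addrCA addrC !mulrDr !mulrDl mulfK ?gt_eqF// mulrN mulNr.
rewrite cosp.
have A0 : 0 <= A by rewrite divr_ge0 ?mulr_ge0 ?ler0n// ltW.
have Ap : A <= p by rewrite ler_pdivrMr// ler_pM2l// ler_nat ltnW.
have S0 : 0 <= S by rewrite divr_ge0 ?mulr_ge0 ?ler0n// ltW.
have S8 : 8 * S <= p.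
  by rewrite mulrA ler_pdivrMr// mulrCA ler_pM2l// -natrM ler_nat.
have [Ah|Ah] := lerP A (p - A); [left|right]; rewrite acosp;
  try lra; by do 2 (rewrite minElt; case: ifPn; rewrite -?leNgt); lra.
Qed.

(** Adding the sum over [s] to the sum over [- s] makes either alternative of [vertex_dist_spread]
    sufficient. At least N/8 shifts qualify, each giving a quarter of the squared distance to twice
    the sum: hence 64. *)
Lemma sum_vertex_dist_sqr_ge a b :
  N%:R * dist (vertex a) (vertex b) ^+ 2 / 64 <=
  \sum_k (dist (vertex b) (vertex k) - dist (vertex a) (vertex k)) ^+ 2.
Proof.
pose c := b - a; rewrite distC distE_vertex -/c.
have sumD : \sum_k (dist (vertex b) (vertex k) - dist (vertex a) (vertex k)) ^+ 2
    = \sum_s (vertex_dist (c + s) - vertex_dist s) ^+ 2.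
  rewrite (reindex (fun s => a - s)) /=; last first.
    by exists (fun k => a - k) => k _; rewrite subKr.
  apply: eq_bigr => s _; rewrite !distE_vertex subKr /c.
  by congr ((vertex_dist _ - _) ^+ 2); rewrite opprB addrCA addrC.
have sumB : \sum_k (dist (vertex b) (vertex k) - dist (vertex a) (vertex k)) ^+ 2
    = \sum_s (vertex_dist (c - s) - vertex_dist s) ^+ 2.
  rewrite sumD (reindex (fun s => - s)) /=; last first.
    by exists (fun k => - k) => k _; rewrite opprK.
  by apply: eq_bigr => s _; rewrite vertex_distN.
set T := \sum_k _ in sumD sumB *.
suff : N%:R / 8 * (vertex_dist c ^+ 2 / 4) <= T + T by lra.
rewrite {1}sumD sumB -big_split /=.
have c0 : 0 <= vertex_dist c by rewrite -distE_vertex dist_ge0.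
apply: (@le_trans _ _ (\sum_(s : 'I_N | (8 * s <= N)%N) vertex_dist c ^+ 2 / 4)).
  rewrite sumr_const; set K := #|_|.
  (* The shifts 0, ..., [N %/ 8] all qualify; counting 0 makes up for the rounding in the
     division. *)
  have dN : ((N %/ 8).+1 <= N)%N by rewrite ltn_Pdiv.
  have KN : (N %/ 8 < K)%N.
    have winj : injective (widen_ord dN).
      by move=> i j /(congr1 val) /= ij; exact: val_inj.
    rewrite -[X in (X <= _)%N]card_ord -(fintype.card_image winj).
    apply: subset_leq_card; apply/fintype.subsetP => _ /fintype.imageP[i _ ->].
    by have := ltn_ord i; rewrite unfold_in /=; lia.
  rewrite -[leRHS]mulr_natl ler_wpM2r ?divr_ge0 ?sqr_ge0//.
  by rewrite ler_pdivrMr// -natrM ler_nat; lia.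
rewrite big_mkcond /=; apply: ler_sum => s _; case: ifPn => [sN|_]; last first.
  by rewrite addr_ge0// sqr_ge0.
have [h|h] := vertex_dist_spread c sN.
- rewrite ler_wpDr ?sqr_ge0// (_ : _ / 4 = (vertex_dist c / 2) ^+ 2); last by field.
  by rewrite ler_sqr ?nnegrE; lra.
- rewrite ler_wpDl ?sqr_ge0// (_ : _ / 4 = (vertex_dist c / 2) ^+ 2); last by field.
  by rewrite ler_sqr ?nnegrE; lra.
Qed.

End RegularPolygon.

(** * Deterministic localization of a minimizer *)

Section Localization.
Context {R : realType} (m : nat).
Local Notation N := m.+1.
Local Notation Z := (@vertex R m).

Lemma dist_diff_le (x y z : circle R) : `|dist y z - dist x z| <= dist x y.
Proof.
have := dist_triangle x y z; have := dist_triangle y x z; rewrite (distC y x).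
by rewrite ler_norml; lra.
Qed.

(* The reflection k |-> a + b - k of the polygon swaps the vertices a and b and
   hence flips the sign of the weights. *)
Lemma signal_gap (g : circle R -> R) (cl eps : R) (a b : 'I_N) :
    0 <= cl -> 0 <= eps ->
    (forall x y, dist (Z a) y <= dist (Z a) x ->
      cl * (dist (Z a) x - dist (Z a) y) - eps <= g y - g x) ->
  cl * (N%:R * dist (Z a) (Z b) ^+ 2 / 128)
    - eps * (N%:R * dist (Z a) (Z b)) / 2 <=
  \sum_k g (Z k) * (dist (Z b) (Z k) - dist (Z a) (Z k)).
Proof.
move=> cl0 eps0 hg; set D := dist (Z a) (Z b).
pose w k := dist (Z b) (Z k) - dist (Z a) (Z k).
pose r k := a + b - k.
have rK : involutive r by move=> k; rewrite /r subKr.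
have Zar k : dist (Z a) (Z (r k)) = dist (Z b) (Z k).
  rewrite !distE_vertex /r -(vertex_distN (b - k)) !opprB opprD.
  by rewrite addrCA [a + _]addrA subrr add0r.
have Zbr k : dist (Z b) (Z (r k)) = dist (Z a) (Z k).
  rewrite !distE_vertex /r -(vertex_distN (a - k)) !opprB [a + b]addrC opprD.
  by rewrite addrCA [b + _]addrA subrr add0r.
(* Averaging this with the original sum pairs each vertex with its mirror image; the factor 2 turns
   64 into 128. *)
have S1 : \sum_k g (Z k) * w k = - \sum_k g (Z (r k)) * w k.
  rewrite (reindex_inj (inv_inj rK)) -sumrN; apply: eq_bigr => k _.
  by rewrite /w Zar Zbr -mulrN opprB.
have wD k : `|w k| <= D by exact: dist_diff_le.
(* [w k] is the distance from [Z a] to the mirror image minus that to [Z k]; the lower bound is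
   applied from the farther of the two, so the gap in [g] has the sign of [w k] up to [eps]. *)
have term k : cl * w k ^+ 2 - eps * D <= (g (Z k) - g (Z (r k))) * w k.
  have := wD k; have := hg (Z (r k)) (Z k); have := hg (Z k) (Z (r k)).
  rewrite Zar /w; move: (dist (Z b) (Z k)) (dist (Z a) (Z k)) => p q.
  move: (g (Z k)) (g (Z (r k))) => x y h1 h2 hD.
  have := normr_ge0 (p - q).
  have [pq|pq] := lerP q p.
    have := h2 pq; rewrite ger0_norm ?subr_ge0// in hD *; nra.
  have := h1 (ltW pq); rewrite ltr0_norm ?subr_lt0// in hD *; nra.
have sumw := @sum_vertex_dist_sqr_ge R m a b; rewrite -/D in sumw.
suff : cl * \sum_k w k ^+ 2 - eps * (N%:R * D) <= 2 * \sum_k g (Z k) * w k.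
  by have := ler_wpM2l cl0 sumw; rewrite /w; lra.
have -> : 2 * (\sum_k g (Z k) * w k) = \sum_k (g (Z k) - g (Z (r k))) * w k.
  rewrite mulr2n mulrDl mul1r {2}S1 -sumrB.
  by apply: eq_bigr => k _; rewrite mulrBl.
rewrite mulr_sumr (_ : eps * _ = \sum_(k < N) eps * D); last first.
  by rewrite sumr_const card_ord -[RHS]mulr_natl mulrCA.
by rewrite -sumrB; apply: ler_sum => k _.
Qed.

(** The probabilistic input is reduced to one inequality on the noise [e] at level [tau]. The factor
    5/2 of [eps] is 1/2 from [signal_gap] plus 2 from the bias. *)
Lemma localization (J : finType) (f : circle R -> circle R -> R)
    (cl cL eps rho tau : R) (a b : 'I_N) (u : circle R) (v : J -> circle R)
    (kappa : J -> 'I_N) (e : J -> R) :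
    0 <= cl -> 0 <= cL -> 0 <= eps -> 0 <= tau ->
    (forall x y, f x y = f y x) ->
    (forall x y y', `|f x y - f x y'| <= cL * dist y y' + eps) ->
    (forall x y y', dist x y' <= dist x y ->
        cl * (dist x y - dist x y') - eps <= f x y' - f x y) ->
    bijective kappa -> dist u (Z a) <= rho ->
    \sum_j (f u (v j) + e j) * dist (Z b) (Z (kappa j)) <=
      \sum_j (f u (v j) + e j) * dist (Z a) (Z (kappa j)) ->
    let w j := dist (Z b) (Z (kappa j)) - dist (Z a) (Z (kappa j)) in
    \sum_j - w j * e j <= tau * Num.sqrt (\sum_j w j ^+ 2) ->
  cl * (N%:R * dist (Z a) (Z b)) <=
  128 * ((5 / 2 * eps + cL * rho) * N%:R
         + cL * \sum_j dist (Z (kappa j)) (v j) + tau * Num.sqrt N%:R).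
Proof.
move=> cl0 cL0 eps0 tau0 fC fL fl kbij hu hmin w hnoise.
set D := dist (Z a) (Z b); set d1 := \sum_j dist _ _.
have D0 : 0 <= D by exact: dist_ge0.
have rho0 : 0 <= rho := le_trans (dist_ge0 _ _) hu.
have d10 : 0 <= d1 by apply: sumr_ge0 => j _; exact: dist_ge0.
have N0 : (0 : R) < N%:R by rewrite ltr0n.
have wD j : `|w j| <= D by exact: dist_diff_le.
have cardJ : #|J| = N by rewrite (bij_eq_card kbij) card_ord.
have sqrtw : Num.sqrt (\sum_j w j ^+ 2) <= Num.sqrt N%:R * D.
  rewrite -[D in leRHS]ger0_norm// -sqrtr_sqr -sqrtrM ?ler0n// ler_wsqrtr//.
  rewrite -cardJ mulr_natl -sumr_const ler_sum// => j _.
  by rewrite -real_normK ?num_real// ler_sqr ?nnegrE// normr_ge0.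
have gap := signal_gap b cl0 eps0 (fl (Z a)).
have sumk : \sum_k f (Z a) (Z k) * (dist (Z b) (Z k) - dist (Z a) (Z k))
    = \sum_j f (Z a) (Z (kappa j)) * w j.
  by rewrite (reindex kappa)//; exact: onW_bij.
rewrite {}sumk -/D in gap.
(* Two moves, [v j] to its vertex and then [u] to [Z a], each cost a Lipschitz term and one
   [eps]. *)
have bias : - (D * (cL * d1 + (2 * eps + cL * rho) * N%:R)) <=
    \sum_j (f u (v j) - f (Z a) (Z (kappa j))) * w j.
  have -> : D * (cL * d1 + (2 * eps + cL * rho) * N%:R)
      = \sum_j D * (cL * dist (Z (kappa j)) (v j) + (2 * eps + cL * rho)).
    rewrite -mulr_sumr; congr (_ * _); rewrite big_split/= -mulr_sumr.
    by rewrite sumr_const cardJ mulr_natr.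
  rewrite -sumrN; apply: ler_sum => j _; rewrite lerNl -mulNr.
  apply: le_trans (ler_norm _) _; rewrite normrM normrN mulrC.
  apply: ler_pM => //.
  have := fL u (v j) (Z (kappa j)); have := fL (Z (kappa j)) u (Z a).
  rewrite -(fC u) -(fC (Z a)) (distC (v j)) => h1 h2.
  have h3 : cL * dist u (Z a) <= cL * rho by rewrite ler_wpM2l.
  have := ler_distD (f u (Z (kappa j))) (f u (v j)) (f (Z a) (Z (kappa j))).
  lra.
have total : \sum_j f (Z a) (Z (kappa j)) * w j
    + \sum_j (f u (v j) - f (Z a) (Z (kappa j))) * w j
    <= \sum_j - w j * e j.
  rewrite -subr_le0 -sumrN -!big_split /=.
  move: hmin; rewrite -subr_le0 -sumrB; congr (_ <= _).
  by apply: eq_bigr => j _; rewrite /w; ring.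
have noise : tau * Num.sqrt (\sum_j w j ^+ 2) <= tau * (Num.sqrt N%:R * D).
  by rewrite ler_wpM2l.
(* The signal is quadratic in [D] and the errors are linear, so one factor [D] cancels. *)
have [D00|Dpos] := eqVneq D 0.
  rewrite D00 !mulr0 mulr_ge0// !addr_ge0// ?mulr_ge0 ?sqrtr_ge0//.
  by rewrite addr_ge0// !mulr_ge0//.
have Dgt0 : 0 < D by rewrite lt0r Dpos.
rewrite -(ler_pM2r Dgt0); lra.
Qed.

End Localization.

(** * Conditional probabilities and independence *)

Section CondProbBound.
Context {R : realType} (d : measure_display) (Omega : measurableType d)
  (P : probability Omega R) (F : set (set Omega)).
Hypotheses (sF : sigma_algebra setT F) (Fm : F `<=` measurable).

Lemma F_measurable_measurable_fun (p : Omega -> R) :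
  F_measurable F p -> measurable_fun setT p.
Proof. by move=> hp _ B mB; rewrite setTI; exact/Fm/hp. Qed.

(** [is_cond_prob] prescribes integrals without stating integrability. An upper bound controls the
    positive part, and finiteness of the integral then controls the negative part. *)
Lemma integrable_upper_bounded (D : set Omega) (p : Omega -> R) (c : R) :
  measurable D -> measurable_fun D p -> (forall w, D w -> p w <= c) ->
  (\int[P]_(w in D) (p w)%:E)%E \is a fin_num ->
  P.-integrable D (EFin \o p).
Proof.
move=> mD mp pc; rewrite integralE => fin.
have mEp : measurable_fun D (EFin \o p) by exact/measurable_EFinP.
have pos_fin : (\int[P]_(w in D) ((EFin \o p)^\+ w) < +oo)%E.
  apply: (@le_lt_trans _ _ (\int[P]_(w in D) (cst (`|c|)%:E w))%E).
    apply: ge0_le_integral => //; first exact: measurable_funepos.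
    move=> w Dw; rewrite funeposE /= -EFin_max lee_fin ge_max normr_ge0 andbT.
    by rewrite (le_trans (pc w Dw)) ?ler_norm.
  rewrite integral_cst// ltey_eq fin_numM//; exact: fin_num_measure.
apply/integrableP; split => //.
rewrite -[fun w => _]/(abse \o (EFin \o p)) fune_abse.
rewrite ge0_integralD//; [|exact: measurable_funepos|exact: measurable_funeneg].
apply: lte_add_pinfty => //.
move: fin; rewrite fin_numB => /andP[_].
by rewrite ge0_fin_numE// integral_ge0.
Qed.

(** The defining identity is tested on the event where [p < c]: there [c - p] is positive but has
    nonpositive integral, so the event is null. *)
Lemma is_cond_prob_ge (G : set Omega) (p : Omega -> R) (c : R) :
    measurable G -> is_cond_prob P F G p ->
    (forall H, F H -> (c%:E * P H <= P (G `&` H))%E) ->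
  {ae P, forall w, c <= p w}.
Proof.
move=> mG [hp intp] hG.
have mp := F_measurable_measurable_fun hp.
pose H := [set w | p w < c].
have FH : F H.
  have -> : H = p @^-1` `]-oo, c[ by apply/seteqP; split=> w; rewrite /= in_itv.
  exact: hp.
have mH : measurable H by exact: Fm.
exists H; split => //; last by move=> w /= /negP; rewrite -ltNge.
have mpH : measurable_fun H p by exact: measurable_funS mp.
have ip : P.-integrable H (EFin \o p).
  apply: (@integrable_upper_bounded _ _ c) => //; first by move=> w /ltW.
  by rewrite intp// fin_num_measure//; exact: measurableI.
have ic : P.-integrable H (EFin \o cst c).
  exact: finite_measure_integrable_cst.
have h0 : (\int[P]_(w in H) `|((EFin \o cst c) \- (EFin \o p)) w| = 0)%E.
  transitivity (\int[P]_(w in H) (((EFin \o cst c) \- (EFin \o p)) w))%E.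
    apply: eq_integral => w; rewrite inE => Hw.
    by rewrite gee0_abs//= -EFinB lee_fin subr_ge0 ltW.
  apply/eqP; rewrite eq_le; apply/andP; split; last first.
    by apply: integral_ge0 => w Hw; rewrite /= -EFinB lee_fin subr_ge0 ltW.
  rewrite integralB// [X in (_ - X)%E]intp//.
  rewrite [X in (X - _)%E](integral_cst P mH c%:E).
  by rewrite leeBlDr ?add0e ?hG// fin_num_measure//; exact: measurableI.
have mB : measurable_fun H ((EFin \o cst c) \- (EFin \o p))%E.
  by apply: emeasurable_funB; exact/measurable_EFinP.
have [N [mN PN HN]] := (ae_eq_integral_abs P mH mB).1 h0.
apply/eqP; rewrite -measure_le0 -PN le_measure ?inE// => w Hw.
apply: HN => /= /(_ Hw) /eqP; rewrite -EFinB eqe subr_eq0 => /eqP cp.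
by move: Hw; rewrite /H /= -cp ltxx.
Qed.

End CondProbBound.

Lemma fsbig_finType (R : Type) (idx : R) (op : Monoid.com_law idx) (V : finType)
    (f : V -> R) :
  \big[op/idx]_(v \in [set: V]) f v = \big[op/idx]_v f v.
Proof.
rewrite (_ : setT = [set` index_enum V]); last first.
  by apply/seteqP; split=> v //= _; rewrite mem_index_enum.
by rewrite -fsbig_seq// index_enum_uniq.
Qed.

Section UnionBound.
Context {R : realType} (d : measure_display) (Omega : measurableType d)
  (P : probability Omega R) (F : set (set Omega)).
Hypotheses (sF : sigma_algebra setT F) (Fm : F `<=` measurable).

Lemma sigma_algebraI (A B : set Omega) : F A -> F B -> F (A `&` B).
Proof.
move=> FA FB; have /sigma_algebraP [//|sT sD snd sI] := sF.
exact: sI.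
Qed.

(** On each fiber of [X] the bad events are frozen and independent of [F]. Summing over fibers
    restores [P H], so the union bound costs only [#|I|] and not the number of values of [X]. *)
Lemma conditional_union_bound (V I : finType) (X : Omega -> V)
    (Bad : V -> I -> set Omega) (G : set Omega) (q : R) :
    (forall v, F (X @^-1` [set v])) ->
    (forall v i, measurable (Bad v i)) ->
    (forall v i A, F A -> P (A `&` Bad v i) = P A * P (Bad v i))%E ->
    (forall v i, P (Bad v i) <= q%:E)%E ->
    measurable G -> (forall w, (forall i, ~ Bad (X w) i w) -> G w) ->
  forall H, F H -> ((1 - #|I|%:R * q)%:E * P H <= P (G `&` H))%E.
Proof.
move=> FX mBad indep Badq mG GBad H FH.
have mH := Fm FH.
pose HX v := H `&` X @^-1` [set v].
have FHX v : F (HX v) by exact: sigma_algebraI.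
have sumH : (\sum_(v : V) P (HX v) = P H)%E.
  have -> : H = \bigcup_(v in setT) HX v.
    by apply/seteqP; split=> [w Hw|w [v _ []]//]; exists (X w).
  rewrite (measure_fin_bigcup _ finite_finset) ?fsbig_finType//; last first.
    by move=> v _; exact/Fm.
  by move=> u v _ _ [w [[_ <-] [_ <-]]].
have bad : (P (H `\` G) <= (#|I|%:R * q)%:E * P H)%E.
  apply: (@le_trans _ _ (\sum_(vi \in setT) P (HX vi.1 `&` Bad vi.1 vi.2))%E).
    apply: content_sub_fsum; first exact: finite_finset.
    - by move=> vi _; apply: measurableI => //; exact/Fm.
    - exact: measurableD.
    move=> w [Hw Gw].
    have [i Bi] : exists i, Bad (X w) i w.
      by apply: contra_notP Gw => /forallNP; exact: GBad.
    by exists (X w, i).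
  rewrite fsbig_finType -(pair_bigA _ (fun v i => P (HX v `&` Bad v i))) /=.
  rewrite -sumH ge0_sume_distrr//; apply: lee_sum => v _.
  have -> : ((#|I|%:R * q)%:E * P (HX v) = \sum_(i : I) q%:E * P (HX v))%E.
    rewrite -[P (HX v)]fineK ?fin_num_measure//; last exact: Fm.
    under eq_bigr do rewrite -EFinM.
    by rewrite -EFinM sumEFin sumr_const -mulrA mulr_natl.
  by apply: lee_sum => i _; rewrite indep// muleC lee_wpmul2r.
have := measureDI P mH mG; rewrite setIC => PH.
rewrite EFinB muleBl ?fin_num_measure// mul1e leeBlDr; last first.
  by rewrite fin_numM// fin_num_measure.
by rewrite {1}PH setIC addeC leeD2l.
Qed.

End UnionBound.

Section PiLambda.
Context {R : realType} (d : measure_display) (Omega : measurableType d)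
  (P : probability Omega R).
Local Open Scope ereal_scope.

(** Pi-lambda argument: the events satisfying the product rule against [B] form a Dynkin system. *)
Lemma indep_generated (G : set (set Omega)) (B : set Omega) :
    setI_closed G -> G `<=` measurable -> measurable B ->
    (forall A, G A -> P (A `&` B) = P A * P B) ->
  forall A, <<s G>> A -> P (A `&` B) = P A * P B.
Proof.
move=> GI Gm mB GB A sGA.
have sGm : <<s G>> `<=` measurable.
  by apply: smallest_sub => //; exact: sigma_algebra_measurable.
suff : [set A | measurable A /\ P (A `&` B) = P A * P B] A by case.
move: A sGA; rewrite -setI_closed_g_dynkin_g_sigma_algebra//.
apply: smallest_sub; last by move=> A GA; split; [exact: Gm|exact: GB].
split=> [|A [mA AB]|S tS SB].
- by split => //; rewrite setTI probability_setT mul1e.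
- split; first exact: measurableC.
  have := measureDI P mB mA; rewrite setDE setIC => PB.
  rewrite probability_setC// muleBl ?fin_num_measure// mul1e -AB.
  by rewrite PB [B `&` A]setIC addeK// fin_num_measure//; exact: measurableI.
- have mS n : measurable (S n) by have [] := SB n.
  split; first exact: bigcup_measurable.
  rewrite setI_bigcupl !measure_bigcup//; last 2 first.
  + by move=> n _; exact: measurableI.
  + by apply: trivIset_setIr.
  rewrite muleC -[X in X * _](@fineK _ (P B)) ?fin_num_measure//.
  rewrite -nneseriesZl//; apply: eq_eseriesr => n _.
  by rewrite fineK ?fin_num_measure// muleC; have [] := SB n.
Qed.

End PiLambda.

Section IndependentBlocks.
Context {R : realType} (d : measure_display) (Omega : measurableType d)
  (P : probability Omega R) (I : finType) (X : I -> {RV P >-> R}).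
Implicit Types J : {set I}.

(** A pi-system generating the sigma-algebra of the variables indexed by [J]; [B] is indexed by all
    of [I] to match [mutual_independence]. *)
Definition rectangles J : set (set Omega) :=
  [set \bigcap_(i in [set i | i \in J]) (X i @^-1` B i)
     | B in [set B : I -> set R | forall i, measurable (B i)]].

Lemma rectangles_setI J : setI_closed (rectangles J).
Proof.
move=> _ _ [B mB <-] [C mC <-]; exists (fun i => B i `&` C i).
  by move=> i; exact: measurableI.
by rewrite -bigcapI; apply: eq_bigcapr => i _; rewrite preimage_setI.
Qed.

Lemma rectangles_measurable J : rectangles J `<=` measurable.
Proof.
move=> _ [B mB <-]; apply: fin_bigcap_measurable => [|i _].
  exact: finite_finset.
by rewrite -[X in measurable X]setTI; exact: measurable_funPT.
Qed.

Lemma rectangles_generated_measurable J : <<s rectangles J>> `<=` measurable.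
Proof.
apply: smallest_sub; first exact: sigma_algebra_measurable.
exact: rectangles_measurable.
Qed.

Lemma preimage_rectangles J i (B : set R) : i \in J -> measurable B ->
  <<s rectangles J>> (X i @^-1` B).
Proof.
move=> iJ mB; apply: sub_sigma_algebra.
exists (fun j => if j == i then B else setT).
  by move=> j; case: ifP.
apply/seteqP; split=> w /=.
  by move=> /(_ i iJ); rewrite /= eqxx.
by move=> Bw j _; rewrite /preimage /=; case: eqP => [->|].
Qed.

(** [indep_generated] is applied once in each argument, which leaves two rectangles over disjoint
    index sets; they glue into one rectangle over the union. *)
Lemma independent_blocks J1 J2 : {in J1, forall i, i \notin J2} ->
    mutual_independence P (fun i => (X i : Omega -> R)) ->
  forall A B, <<s rectangles J1>> A -> <<s rectangles J2>> B ->
    (P (A `&` B) = P A * P B)%E.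
Proof.
move=> J12 hX A B sA sB.
have mA := rectangles_generated_measurable sA.
have mB := rectangles_generated_measurable sB.
move: A sA {mA}; apply: indep_generated => //.
- exact: rectangles_setI.
- exact: rectangles_measurable.
move=> A rA; have mA := rectangles_measurable rA.
move: B sB {mB} => B sB; rewrite setIC muleC; move: B sB.
apply: indep_generated => //.
- exact: rectangles_setI.
- exact: rectangles_measurable.
move=> _ [C mC <-]; case: rA => B mB <-.
have dJ : fintype.disjoint (mem J1) (mem J2).
  by apply/pred0P => i /=; apply/negbTE/negP => /andP[/J12/negP].
have mBC i : measurable (if i \in J1 then B i else C i) by case: ifP.
have := hX (J1 :|: J2) _ mBC.
rewrite (eq_bigl (fun i => i \in [predU J1 & J2])); last by move=> i; rewrite !inE.
rewrite (bigU _ _ _ dJ)/= => hBC.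
have -> : \bigcap_(i in [set i | i \in J2]) (X i @^-1` C i) `&`
    \bigcap_(i in [set i | i \in J1]) (X i @^-1` B i) =
  \bigcap_(i in [set i | i \in J1 :|: J2])
     (X i @^-1` (if i \in J1 then B i else C i)).
  apply/seteqP; split=> [w [wC wB] i /=|w h].
    by rewrite inE; case: ifPn => [iJ _|_ /= iJ]; [exact: wB|exact: wC].
  split=> i /= iJ; have := h i; rewrite /= inE iJ ?orbT => /(_ isT)//.
  by rewrite (disjointFl dJ iJ).
rewrite hBC muleC (hX J2)// (hX J1)//; congr (_ * _)%E.
  by apply: eq_bigr => i iJ; rewrite (disjointFl dJ iJ).
by apply: eq_bigr => i ->.
Qed.

(** The finite sum is measurable once [Omega] carries the sigma-algebra generated by the rectangles;
    terms outside [J] vanish. *)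
Lemma rectangles_linear_gt J (b : I -> R) (c : R) :
    (forall i, i \notin J -> b i = 0) ->
  <<s rectangles J>> [set w | c < \sum_i b i * X i w].
Proof.
move=> b0; pose U := g_sigma_algebraType (rectangles J).
have mX i : measurable_fun [set: U] (fun w : U => b i * X i w).
  have [iJ|iJ] := boolP (i \in J); last first.
    by rewrite b0//; under eq_fun do rewrite mul0r; exact: measurable_cst.
  apply: measurable_funM => //.
  by move=> _ B mB; rewrite setTI; exact: preimage_rectangles.
have msum : measurable_fun [set: U] (fun w : U => \sum_i b i * X i w).
  exact: measurable_sum.
have := msum measurableT `]c, +oo[%classic (measurable_itv _).
by rewrite setTI; congr (<<s _>> _); apply/seteqP; split=> w /=;
  rewrite in_itv/= andbT.
Qed.

End IndependentBlocks.

(** * Linear forms of the noise along a star *)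

Section StarSums.
Context {R : realType} (n : nat) (S : {set 'I_n}) (i : 'I_n) (w : 'I_n -> R).
Hypothesis iS : i \notin S.

(* [subGaussian1] only reads the entries above the diagonal, hence the two cases. *)
Definition star_mx : 'M[R]_n := \matrix_(k, l)
  if (k == i) && (l \in S) then w l
  else if (l == i) && (k \in S) then w k else 0.

(** A general [phi] treats both the variance ([phi] a square) and the linear form ([phi] a product
    with the noise). Since [i] is outside [S], the row and column cases never overlap. *)
Lemma sum_star (phi : 'I_n -> 'I_n -> R -> R) :
    (forall k l, phi k l 0 = 0) ->
  \sum_(k < n) \sum_(l < n | (k < l)%N) phi k l (star_mx k l) =
  \sum_(j in S) (if (i < j)%N then phi i j (w j) else phi j i (w j)).
Proof.
move=> phi0.
have E (k l : 'I_n) : (k < l)%N -> phi k l (star_mx k l) =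
    (if (k == i) && (l \in S) then phi k l (w l) else 0) +
    (if (l == i) && (k \in S) then phi k l (w k) else 0).
  move=> kl; rewrite mxE; case: ifPn => [/andP[/eqP -> lS]|_].
    by rewrite (negbTE iS) andbF addr0.
  by rewrite add0r; case: ifP => // _; rewrite phi0.
under eq_bigr do under eq_bigr => l kl do rewrite E//.
under eq_bigr do rewrite big_split/=.
rewrite big_split /= (bigD1 i)//= [X in _ + X + _]big1 ?addr0; last first.
  by move=> k ki; rewrite big1// => l _; rewrite (negbTE ki).
under eq_bigr do rewrite eqxx/=.
have -> : \sum_(k < n) \sum_(l < n | (k < l)%N)
      (if (l == i) && (k \in S) then phi k l (w k) else 0) =
    \sum_(k < n) (if (k \in S) && (k < i)%N then phi k i (w k) else 0).
  apply: eq_bigr => k _; rewrite big_mkcond (bigD1 i)//= eqxx/=.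
  rewrite big1 ?addr0; last first.
    by move=> l li; rewrite (negbTE li); case: ifP.
  by case: (k \in S) => //=; case: ifP.
rewrite big_mkcond -big_split [RHS]big_mkcond /=; apply: eq_bigr => j _.
have [jS|jS] := boolP (j \in S); last by rewrite addr0; case: ifP.
have ij : (i : nat) != j by apply: contra iS => /eqP/val_inj ->.
by rewrite /=; case: (ltngtP i j) ij => //=; rewrite ?addr0 ?add0r.
Qed.

End StarSums.

(** * Finite codes for polygon-valued estimators *)

Section VertexIndex.
Context {R : realType} (m : nat).
Local Notation N := m.+1.

Lemma dist_refl (x : circle R) : dist x x = 0.
Proof. by rewrite /dist subrr normr0 subr0 min_l// mulrn_wge0// pi_ge0. Qed.

Lemma vertex_inj : injective (@vertex R m).
Proof.
move=> a b ab; have : dist (@vertex R m a) (vertex b) = 0 by rewrite ab dist_refl.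
rewrite distE_vertex vertex_distE; set c := a - b.
have p0 : (0 : R) < pi *+ 2 by rewrite pmulrn_rgt0 ?pi_gt0.
have cN : pi *+ 2 * c%:R / N%:R < pi *+ 2 :> R.
  by rewrite ltr_pdivrMr ?ltr0n// ltr_pM2l// ltr_nat.
have min0 (x p : R) : x < p -> Num.min x (p - x) = 0 -> x = 0.
  by rewrite minElt; case: ifP => // _; lra.
move=> /(min0 _ _ cN).
move/eqP; rewrite !mulf_eq0 invr_eq0 !pnatr_eq0 orbF (gt_eqF p0) /=.
by move=> /eqP c0; apply/eqP; rewrite -subr_eq0; apply/eqP/val_inj.
Qed.

(** Inverse of [vertex]; the default [ord0] is only taken off the polygon. *)
Definition vertex_index (z : circle R) : 'I_N := xget ord0 [set a | z = vertex a].

Lemma vertex_indexK z : C_ N z -> vertex (vertex_index z) = z.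
Proof.
by move=> /C_vertex[a za]; rewrite /vertex_index; case: xgetP => [b _ ->//|/(_ a)].
Qed.

Lemma vertex_index_vertex a : vertex_index (vertex a) = a.
Proof. by apply/vertex_inj/vertex_indexK/C_vertex; exists a. Qed.

Lemma vertex_index_bij (I : finType) (y : I -> circle R) :
  #|I| = N -> Pi_ I N y -> bijective (vertex_index \o y).
Proof.
move=> cardI [Cy uy]; apply: inj_card_bij; last by rewrite cardI card_ord.
move=> i j /= ij; have yij : y i = y j.
  by rewrite -(vertex_indexK (Cy i)) ij vertex_indexK.
by have [k [_ h]] := uy _ (Cy i); rewrite -(h i erefl) -(h j (esym yij)).
Qed.

End VertexIndex.

Section FiniteValued.
Context {R : realType} (T : Type) (F : set (set T)).
Hypothesis sF : sigma_algebra setT F.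

Lemma sigma_algebra_fin_bigcap (I : finType) (A : I -> set T) :
  (forall i, F (A i)) -> F (\bigcap_i A i).
Proof.
move=> FA; rewrite -bigsetI_fset_set; last exact: finite_finset.
have [FT _ _ FI] := (sigma_algebraP (fun X _ => @subsetT _ X)).1 sF.
by elim/big_ind: _ => //; exact: FI.
Qed.

Lemma sigma_algebra_fibers (V : finType) (Y : T -> V) (B : set V) :
  (forall v, F (Y @^-1` [set v])) -> F (Y @^-1` B).
Proof.
move=> FY; have FC A : F A -> F (~` A).
  by move=> FA; rewrite -setTD; case: sF => _ sC _; exact: sC.
rewrite -[X in F X]setCK; apply: (FC).
rewrite (_ : ~` _ = \bigcap_v
    (if v \in B then ~` (Y @^-1` [set v]) else setT)); last first.
  apply/seteqP; split=> [w /= nB v _|w /= h nB].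
    by case: ifPn => // /set_mem vB /= wv; apply: nB; rewrite /preimage /= wv.
  by have := h (Y w) I; rewrite ifT ?inE//; exact.
apply: sigma_algebra_fin_bigcap => v; case: ifP => _; first exact: FC.
by have [sT _ _] := sigma_algebra_dynkin sF.
Qed.

Lemma F_measurable_circle_fiber (Y : T -> circle R) z :
  F_measurable_circle F Y -> F (Y @^-1` [set z]).
Proof.
move=> mY.
rewrite (_ : _ @^-1` _ = \bigcap_(k : 'I_2)
    ((fun t => val (Y t) k 0) @^-1` [set val z k 0])); last first.
  apply/seteqP; split=> [w <- //|w h]; apply/val_inj/matrixP => k l.
  by rewrite (ord1 l); exact: h.
by apply: sigma_algebra_fin_bigcap => k; exact: mY.
Qed.

(** Turns a measurable estimator into a variable with finitely many values, whose fibers are cut out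
    by finitely many coordinates. *)
Lemma F_vertex_index_fiber (m : nat) (I : finType) (Y : T -> I -> circle R)
    (v : {ffun I -> 'I_m.+1}) :
    (forall i, F_measurable_circle F (Y ^~ i)) ->
    (forall t i, C_ m.+1 (Y t i)) ->
  F ((fun t => [ffun i => vertex_index m (Y t i)]) @^-1` [set v]).
Proof.
move=> mY CY; rewrite (_ : _ @^-1` _ =
    \bigcap_i ((Y ^~ i) @^-1` [set vertex (v i)])); last first.
  apply/seteqP; split=> [w <- i _|w h].
    by rewrite /preimage /= ffunE vertex_indexK.
  by apply/ffunP => i; rewrite ffunE (h i)// vertex_index_vertex.
by apply: sigma_algebra_fin_bigcap => i; exact: F_measurable_circle_fiber.
Qed.

End FiniteValued.

Lemma d_inf_Pi_ge0 (R : realType) (I : finType) (x : I -> circle R) k :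
  0 <= d_inf_Pi x k.
Proof.
rewrite /d_inf_Pi; set D := [set _ | _ in _].
have [->|D0] := eqVneq D set0; first by rewrite inf0.
by apply: lb_le_inf; [exact/set0P|move=> _ [y _ <-]; exact: bigmax_ge_id].
Qed.

(** * Rates and constants *)

Section Rate.
Context {R : realType} (m : nat).
Local Notation n := (4 * m.+1)%N.
Local Notation r := (Num.sqrt (ln n%:R / n%:R) : R).

(** From ln(1/2) <= -1/2 comes ln 4 >= 1, and n >= 4. *)
Lemma ln_sample_ge1 : 1 <= ln n%:R :> R.
Proof.
have n4 : (4 : R) <= n%:R by rewrite ler_nat; lia.
have : ln (1 + (2^-1 - 1)) <= 2^-1 - 1 :> R by apply: le_ln1Dx; lra.
rewrite addrC subrK lnV ?posrE// => h.
apply: (@le_trans _ _ (ln 4)); last by rewrite ler_ln ?posrE//; lra.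
have -> : (4 : R) = 2 * 2 by lra.
rewrite lnM ?posrE//; lra.
Qed.

Lemma inv_le_rate : n%:R^-1 <= r.
Proof.
have n0 : (0 : R) < n%:R by rewrite ltr0n.
have n1 : (1 : R) <= n%:R by rewrite ler1n.
rewrite -[leLHS]ger0_norm ?invr_ge0 ?(ltW n0)// -sqrtr_sqr ler_wsqrtr//.
rewrite expr2 ler_pM2r ?invr_gt0//.
by apply: le_trans ln_sample_ge1; rewrite invf_le1.
Qed.

(** With n = 4N the squares are 8 N ln n and 9 N ln n, which is where 6 comes from. *)
Lemma noise_le_rate :
  Num.sqrt (8 * ln n%:R) * Num.sqrt m.+1%:R <= 6 * r * m.+1%:R.
Proof.
have N0 : (0 : R) < m.+1%:R by rewrite ltr0n.
have ln0 : 0 <= ln n%:R :> R by rewrite (le_trans ler01 ln_sample_ge1).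
rewrite -ler_sqr ?nnegrE ?mulr_ge0 ?sqrtr_ge0 ?(ltW N0)//.
rewrite !exprMn !sqr_sqrtr ?mulr_ge0 ?divr_ge0 ?ler0n//.
rewrite natrM.
have -> : 6 ^+ 2 * (ln (4 * m.+1%:R) / (4 * m.+1%:R)) * m.+1%:R ^+ 2
   = 9 * ln (4 * m.+1%:R) * m.+1%:R :> R.
  move: (ln _) => l; move: (m.+1%:R : R) N0 => N N0.
  by field; rewrite gt_eqF.
by rewrite ler_pM2r// ler_wpM2r -?natrM//; lra.
Qed.

(** The level sqrt(8 ln n) has tail n^-4, and at most n^2 events leave n^-2. *)
Lemma union_le_rate (k : nat) : (k <= n * n)%N ->
  k%:R * expR (- Num.sqrt (8 * ln n%:R) ^+ 2 / 2) <= 1 / n%:R ^+ 2 :> R.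
Proof.
move=> kn; have n0 : (0 : R) < n%:R by rewrite ltr0n.
have ln0 : 0 <= ln n%:R :> R by rewrite (le_trans ler01 ln_sample_ge1).
rewrite sqr_sqrtr ?mulr_ge0//.
have -> : - (8 * ln n%:R) / 2 = 4 * - ln n%:R :> R by lra.
rewrite expRM_natl expRN lnK ?posrE//.
have kn2 : k%:R <= n%:R ^+ 2 :> R by rewrite expr2 -natrM ler_nat.
apply: (@le_trans _ _ (n%:R ^+ 2 * n%:R^-1 ^+ 4)).
  by rewrite ler_wpM2r// exprn_ge0// invr_ge0 ltW.
by rewrite le_eqVlt; apply/predU1P; left; field; rewrite gt_eqF.
Qed.

End Rate.

(** The polygon step is 8 pi / n <= 8 pi r, and d1 = 4 N (d1 / n); these give the terms in [cL]. The
    last 8 pi pays for the extra [rho] on the left. *)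
Lemma rate_bound (R : realType) (cl cL ce D rho d1 delta r N n : R) :
    0 <= ce -> 0 < cl -> 0 <= cL -> 0 < N -> n = 4 * N ->
    0 <= d1 -> 0 <= delta -> n^-1 <= r -> rho = pi *+ 2 / N ->
    cl * (N * D) <=
      128 * ((5 / 2 * (ce * r) + cL * rho) * N + cL * d1 + 6 * r * N) ->
  D + rho <= (128 / cl * (5 / 2 * ce + 8 * pi * cL + 4 * cL + 6) + 8 * pi) *
    (delta + d1 / n + r).
Proof.
move=> ce0 cl0 cL0 N0 nE d10 delta0 nr rhoE h.
have p0 := @pi_gt0 R.
have n0 : 0 < n by rewrite nE mulr_gt0.
have r0 : 0 <= r by apply: le_trans nr; rewrite invr_ge0 ltW.
have rhor : rho <= 8 * pi * r.
  have -> : rho = 8 * pi * n^-1 by rewrite rhoE nE mulr2n; field; rewrite gt_eqF.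
  by rewrite ler_wpM2l// mulr_ge0// ltW.
set e := d1 / n.
have e0 : 0 <= e by rewrite divr_ge0// ltW.
have d1E : d1 = 4 * e * N by rewrite /e nE; field; rewrite gt_eqF.
have h2 : D <= 128 / cl * (5 / 2 * (ce * r) + cL * rho + 4 * cL * e + 6 * r).
  rewrite mulrAC ler_pdivlMr// mulrC -(ler_pM2r N0).
  by move: h; rewrite d1E; lra.
have K0 : 0 <= 128 / cl by rewrite divr_ge0// ltW.
have cLr : cL * rho <= cL * (8 * pi * r) by rewrite ler_wpM2l.
set K := 5 / 2 * ce + 8 * pi * cL + 4 * cL + 6.
have pcL : 0 <= pi * cL by rewrite mulr_ge0// ltW.
have h3 : 5 / 2 * (ce * r) + cL * rho + 4 * cL * e + 6 * r
    <= K * (delta + e + r).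
  have : 0 <= ce * delta by rewrite mulr_ge0.
  have : 0 <= ce * e by rewrite mulr_ge0.
  have : 0 <= pi * cL * delta by rewrite mulr_ge0.
  have : 0 <= pi * cL * e by rewrite mulr_ge0.
  have : 0 <= cL * delta by rewrite mulr_ge0.
  have : 0 <= cL * r by rewrite mulr_ge0.
  rewrite /K; lra.
have := ler_wpM2l K0 h3.
have : 0 <= pi * delta by rewrite mulr_ge0// ltW.
have : 0 <= pi * e by rewrite mulr_ge0// ltW.
lra.
Qed.

(** * Noise events and the sigma-algebra of the observed block *)

Section NoiseEvents.
Context {R : realType} (d : measure_display) (Omega : measurableType d)
  (P : probability Omega R) (n : nat) (E : 'I_n -> 'I_n -> {RV P >-> R})
  (S : {set 'I_n}).

Local Notation edge := {ij : 'I_n * 'I_n | (ij.1 < ij.2)%N}.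

Definition edge_noise (ij : edge) : {RV P >-> R} := E (val ij).1 (val ij).2.

Definition inner_edges : {set edge} :=
  finset (fun ij : edge => ((val ij).1 \in S) && ((val ij).2 \in S)).

Definition sym_noise (i j : 'I_n) (w : Omega) : R :=
  if (i < j)%N then E i j w else E j i w.

Definition noise_event (t : R) (i : 'I_n) (b : 'I_n -> R) : set Omega :=
  [set w | t * Num.sqrt (\sum_(j in S) b j ^+ 2)
           < \sum_(j in S) b j * sym_noise i j w].

Lemma sum_edges (phi : 'I_n -> 'I_n -> R) :
  \sum_(k < n) \sum_(l < n | (k < l)%N) phi k l =
  \sum_(ij : edge) phi (val ij).1 (val ij).2.
Proof.
rewrite pair_big_dep /=.
exact: (big_sub [pred p : 'I_n * 'I_n | (p.1 < p.2)%N] (fun p => phi p.1 p.2)).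
Qed.

Lemma noise_eventE t i b : i \notin S ->
  noise_event t i b =
  [set w | t * Num.sqrt (\sum_(k < n) \sum_(l < n | (k < l)%N) star_mx S i b k l ^+ 2)
    < \sum_(k < n) \sum_(l < n | (k < l)%N) star_mx S i b k l * E k l w].
Proof.
move=> iS; rewrite (@sum_star _ _ S i b iS (fun _ _ x => x ^+ 2)); last first.
  by move=> _ _; rewrite expr0n.
apply: eq_set => w.
rewrite (@sum_star _ _ S i b iS (fun k l x => x * E k l w)); last first.
  by move=> k l; rewrite mul0r.
congr (is_true (_ * Num.sqrt _ < _)); apply: eq_bigr => j _.
  by case: ifP.
by rewrite /sym_noise; case: ifP.
Qed.

Lemma noise_event_tail t i b : i \notin S -> 0 <= t ->
    subGaussian1 P (fun i j => (E i j : Omega -> R)) ->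
  (P (noise_event t i b) <= (expR (- t ^+ 2 / 2))%:E)%E.
Proof. by move=> iS t0 hE; rewrite noise_eventE//; exact: hE. Qed.

(** Every edge of a star centered outside [S] has an endpoint outside [S]. *)
Lemma noise_event_outer t i b : i \notin S ->
  <<s rectangles edge_noise (~: inner_edges)%SET>> (noise_event t i b).
Proof.
move=> iS; rewrite noise_eventE//.
under eq_set => w do rewrite (sum_edges (fun k l => star_mx S i b k l * E k l w)).
apply: (@rectangles_linear_gt _ _ _ _ _ edge_noise _
  (fun ij => star_mx S i b (val ij).1 (val ij).2)) => ij.
rewrite !inE negbK mxE => /andP[h1 h2].
rewrite ifN; last by apply: contra iS => /andP[/eqP <-].
by rewrite ifN//; apply: contra iS => /andP[/eqP <-].
Qed.

Lemma sigma_of_inner (A : Omega -> 'M[R]_n) (mu : 'I_n -> 'I_n -> R) :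
    (forall w, (A w)^T = A w) -> (forall w i, A w i i = 0) ->
    (forall w (i j : 'I_n), (i < j)%N -> A w i j = mu i j + E i j w) ->
  sigma_of (fun w => submatrix S (A w))
    `<=` <<s rectangles edge_noise inner_edges>>.
Proof.
move=> hsym hdiag hA.
set F := <<s _>>; have sF : sigma_algebra setT F by exact: smallest_sigma_algebra.
(* The sets whose preimage lies in [F] form a sigma-algebra, so single entries suffice: above the
   diagonal, below it by symmetry, and constant on it. *)
suff : matrix_sigma R (idx S)
    `<=` image_set_system setT (fun w => submatrix S (A w)) F.
  by move=> h _ [K /h + <-].
apply: smallest_sub; first exact: sigma_algebra_image.
have upper (i j : 'I_n) (B : set R) : i \in S -> j \in S -> (i < j)%N ->
    measurable B -> F ((fun w => A w i j) @^-1` B).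
  move=> iS jS ij mB; pose e : edge := exist _ (i, j) ij.
  have -> : (fun w => A w i j) @^-1` B =
      edge_noise e @^-1` ((fun x => mu i j + x) @^-1` B).
    by apply/seteqP; split=> w; rewrite /preimage /= hA.
  apply: preimage_rectangles; first by rewrite inE /= iS jS.
  have mshift : measurable_fun [set: R] (fun x : R => mu i j + x).
    by apply: measurable_funD => //; exact: measurable_cst.
  by rewrite -[X in measurable X]setTI; exact: mshift.
move=> _ [[i j] _ [B mB <-]]; rewrite /image_set_system /= setTI.
rewrite -[X in F X]/((fun w => A w (val i) (val j)) @^-1` ([set: R] `&` B)) setTI.
have [ij|ji|ij] := ltngtP (val i) (val j).
- exact: upper (valP i) (valP j) ij mB.
- rewrite (_ : _ @^-1` B = (fun w => A w (val j) (val i)) @^-1` B).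
    exact: upper (valP j) (valP i) ji mB.
  by apply/seteqP; split=> w; rewrite /preimage /= -[in A w (val i) _]hsym mxE.
- have -> : (fun w => A w (val i) (val j)) = cst 0.
    by apply/funext => w; rewrite -(val_inj ij) hdiag.
  rewrite preimage_cst; case: ifP => _.
    by have [FT _ _] := sigma_algebra_dynkin sF.
  by case: sF.
Qed.

Lemma observed_edge (A : Omega -> 'M[R]_n) (mu : 'I_n -> 'I_n -> R) w i j :
    (forall w, (A w)^T = A w) -> (forall i j, mu i j = mu j i) ->
    (forall w (i j : 'I_n), (i < j)%N -> A w i j = mu i j + E i j w) ->
  i != j -> A w i j = mu i j + sym_noise i j w.
Proof.
move=> hsym muC hA; rewrite /sym_noise -val_eqE neq_ltn => /orP[ij|ji].
  by rewrite ij hA.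
by rewrite ltnNge (ltnW ji) /= muC -hA// -[in LHS]hsym mxE.
Qed.

End NoiseEvents.

(** * The estimator *)

Lemma row_estimate (R : realType) (cl cL ce : R) (m : nat)
    (f : circle R -> circle R -> R) (Q : orthogonal2 R) (J : finType)
    (x : circle R) (y xh : J -> circle R) (A e : J -> R) (a b : 'I_m.+1)
    (delta : R) :
  let n := (4 * m.+1)%N in
  let r := Num.sqrt (ln n%:R / n%:R) in
  let w j := dist (vertex b) (xh j) - dist (vertex a) (xh j) in
    0 <= ce -> 0 < cl -> 0 <= cL -> BL cl cL ce n f ->
    #|J| = m.+1 -> Pi_ J m.+1 xh -> (forall j, A j = f x (y j) + e j) ->
    dist (orthogonal2_act Q x) (vertex a) <= pi *+ 2 / m.+1%:R ->
    \sum_j A j * dist (vertex b) (xh j) <= \sum_j A j * dist (vertex a) (xh j) ->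
    \sum_j - w j * e j <= Num.sqrt (8 * ln n%:R) * Num.sqrt (\sum_j w j ^+ 2) ->
    0 <= delta ->
  dist (vertex b) (orthogonal2_act Q x) <=
    (128 / cl * (5 / 2 * ce + 8 * pi * cL + 4 * cL + 6) + 8 * pi) *
    (delta + d_1 xh (fun j => orthogonal2_act Q (y j)) / n%:R + r).
Proof.
move=> n r w ce0 cl0 cL0 [_ fC fL fl] cardJ hxh hA ha hmin hnoise delta0.
have [Cxh _] := hxh.
pose kappa := vertex_index m \o xh.
have kbij : bijective kappa by exact: vertex_index_bij.
have kE j : vertex (kappa j) = xh j by exact: vertex_indexK.
pose Qi := orthogonal2_inv Q.
(* Pulling [f] back by the inverse of [Q] keeps its bi-Lipschitz bounds, as [Q] is an isometry, and
   moves the true positions to their images under [Q]. *)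
pose g u v := f (orthogonal2_act Qi u) (orthogonal2_act Qi v).
have gE u v : g (orthogonal2_act Q u) (orthogonal2_act Q v) = f u v.
  by rewrite /g !orthogonal2_invK.
have r0 : 0 <= r by exact: sqrtr_ge0.
have eps0 : 0 <= ce * r by rewrite mulr_ge0.
have loc := @localization R m J g cl cL (ce * r) (pi *+ 2 / m.+1%:R)
  (Num.sqrt (8 * ln n%:R)) a b (orthogonal2_act Q x)
  (fun j => orthogonal2_act Q (y j)) kappa e (ltW cl0) cL0 eps0 (sqrtr_ge0 _).
have {loc} : cl * (m.+1%:R * dist (@vertex R m a) (vertex b)) <=
  128 * ((5 / 2 * (ce * r) + cL * (pi *+ 2 / m.+1%:R)) * m.+1%:R
         + cL * d_1 xh (fun j => orthogonal2_act Q (y j))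
         + Num.sqrt (8 * ln n%:R) * Num.sqrt m.+1%:R).
  rewrite /d_1; under [in leRHS]eq_bigr do rewrite -kE.
  apply: loc => //.
  - by move=> u v; rewrite /g fC.
  - by move=> u v v'; rewrite -(dist_act Qi v v'); exact: fL.
  - move=> u v v'; rewrite -(dist_act Qi u v) -(dist_act Qi u v'); exact: fl.
  - under eq_bigr do rewrite gE -hA kE.
    by under [leRHS]eq_bigr do rewrite gE -hA kE.
  - under eq_bigr do rewrite !kE.
    by under [X in _ <= _ * Num.sqrt X]eq_bigr do rewrite !kE.
have := @noise_le_rate R m; rewrite -/n -/r => hn hD.
apply: le_trans (dist_triangle (vertex a) _ _) _.
rewrite (distC (vertex a) (orthogonal2_act Q x)) (distC (vertex b)).
apply: le_trans (lerD (lexx _) ha) _.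
apply: (@rate_bound _ cl cL ce _ _ _ _ _ m.+1%:R) => //.
- by rewrite /n natrM.
- by apply: sumr_ge0 => j _; exact: dist_ge0.
- exact: inv_le_rate.
- apply: le_trans hD _; by rewrite ler_pM2l ?lerD2l.
Qed.

Unset Implicit Arguments.
Theorem proposition3p5 (R : realType) (cl cL ce : R)
    (hce : 0 <= ce) (hcl : 0 < cl) (hclL : cl <= cL) :
  exists C : R,
  forall (n : nat) (hn : (0 < n)%N) (hn4 : (4 %| n)%N)
    (xstar : 'I_n -> circle R) (f : circle R -> circle R -> R)
    (hf : BL cl cL ce n f)
    (d : measure_display) (Omega : measurableType d) (P : probability Omega R)
    (E : 'I_n -> 'I_n -> {RV P >-> R})
    (hEcentered : forall i j : 'I_n, (i < j)%N -> centered (E i j))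
    (hEindep : mutual_independence P
       (fun (ij : {ij : 'I_n * 'I_n | (ij.1 < ij.2)%N}) =>
          (E (val ij).1 (val ij).2 : Omega -> R)))
    (hEsub : subGaussian1 P (fun i j => (E i j : Omega -> R)))
    (A : Omega -> 'M[R]_n)
    (hAsym : forall w, (A w)^T = A w)
    (hAdiag : forall w i, A w i i = 0)
    (hA : forall w (i j : 'I_n), (i < j)%N ->
       A w i j = f (xstar i) (xstar j) + E i j w)
    (S : {set 'I_n}) (hS : #|S| = (n %/ 4)%N)
    (xhat1 : (idx S -> idx S -> R) -> idx S -> circle R)
    (hxhat1meas : forall i : idx S,
       F_measurable_circle (matrix_sigma R (idx S)) (fun M => xhat1 M i))
    (hxhat1 : forall M, Pi_ (idx S) (n %/ 4) (xhat1 M))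
    (xhat2 : Omega -> idx (~: S) -> circle R)
    (hxhat2meas : forall i : idx (~: S),
       F_measurable_circle (@measurable d Omega) (fun w => xhat2 w i))
    (hxhat2 : forall w (i : idx (~: S)),
       argmin (C_ (n %/ 4))
         (fun z => \sum_(j : idx S)
            A w (val i) (val j) * dist z (xhat1 (submatrix S (A w)) j))
         (xhat2 w i)),
  let A_SS := fun w => submatrix S (A w) in
  forall Q : orthogonal2 R,
  let Qxstar := fun i => orthogonal2_act Q (xstar i) in
  {ae P, forall w,
    1 - 1 / n%:R ^+ 2 <=
    cond_prob P (sigma_of A_SS)
      [set w' | d_inf (xhat2 w') (coords (~: S) Qxstar) <=
         C * (d_inf_Pi (coords S xstar) (n %/ 4)
              + d_1 (xhat1 (A_SS w')) (coords S Qxstar) / n%:R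
              + Num.sqrt (ln n%:R / n%:R))] w}.
Proof.
(* The constant of [row_estimate], fixed before [n]. *)
exists (128 / cl * (5 / 2 * ce + 8 * pi * cL + 4 * cL + 6) + 8 * pi).
set C := _ + 8 * pi.
move=> n hn hn4.
have [m nE] : exists m, n = (4 * m.+1)%N by exists (n %/ 4).-1; lia.
subst n; rewrite mulKn// {hn hn4} => xstar f hf d Omega P E _ hEindep hEsub
  A hAsym hAdiag hA S hS xhat1 hxhat1meas hxhat1 xhat2 hxhat2meas hxhat2
  A_SS Q Qxstar.
have cL0 : 0 <= cL by rewrite (le_trans (ltW hcl)).
pose F := sigma_of A_SS.
have sF : sigma_algebra setT F by exact: sigma_of_sigma_algebra.
have Finner : F `<=` <<s rectangles (edge_noise E) (inner_edges S)>>.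
  exact: (sigma_of_inner hAsym hAdiag hA).
have Fm : F `<=` measurable.
  by move=> B /Finner; exact: rectangles_generated_measurable.
pose V1 := {ffun idx S -> 'I_m.+1}.
pose V2 := {ffun idx (~: S) -> 'I_m.+1}.
pose X1 w : V1 := [ffun j => vertex_index m (xhat1 (A_SS w) j)].
pose X2 w : V2 := [ffun j => vertex_index m (xhat2 w j)].
have X1K w j : vertex (X1 w j) = xhat1 (A_SS w) j.
  by rewrite ffunE vertex_indexK//; have [] := hxhat1 (A_SS w).
have X2K w j : vertex (X2 w j) = xhat2 w j.
  by rewrite ffunE vertex_indexK//; have [] := hxhat2 w j.
have FX1 v : F (X1 @^-1` [set v]).
  apply: (F_vertex_index_fiber sF) => [j k B mB|w j]; last first.
    by have [] := hxhat1 (A_SS w).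
  by exists ((fun M => val (xhat1 M j) k 0) @^-1` B);
    [exact: hxhat1meas|rewrite setTI].
have mX2 v : measurable (X2 @^-1` [set v]).
  apply: (F_vertex_index_fiber (@sigma_algebra_measurable _ Omega)) => //.
  by move=> w j; have [] := hxhat2 w j.
set G := [set w' | _].
(* [G] depends on [w] only through the finite codes [X1] and [X2]. *)
have mG : measurable G.
  pose Y w := (X1 w, X2 w).
  have -> : G = Y @^-1` [set v : V1 * V2 |
      d_inf (fun j => vertex (v.2 j)) (coords (~: S) Qxstar) <=
         C * (d_inf_Pi (coords S xstar) m.+1
              + d_1 (fun j => vertex (v.1 j)) (coords S Qxstar) / (4 * m.+1)%:R
              + Num.sqrt (ln (4 * m.+1)%:R / (4 * m.+1)%:R))].
    apply: eq_set => w.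
    have -> : xhat1 (A_SS w) = (fun j => vertex (X1 w j)) by apply/funext.
    by have -> : xhat2 w = (fun j => vertex (X2 w j)) by apply/funext.
  apply: (sigma_algebra_fibers (@sigma_algebra_measurable _ Omega)) => -[v1 v2].
  rewrite (_ : _ @^-1` _ = X1 @^-1` [set v1] `&` X2 @^-1` [set v2]).
    by apply: measurableI => //; exact/Fm.
  apply/seteqP; split=> w; rewrite /preimage /= => -[h1 h2]; first by [].
  by rewrite /Y h1 h2.
have [a aP] := choice (fun i : idx (~: S) =>
  vertex_near m (Qxstar (val i))).
have outer (i : idx (~: S)) : val i \notin S by have := valP i; rewrite inE.
pose t := Num.sqrt (8 * ln (4 * m.+1)%:R) : R.
(* Weights for a frozen code [v] and a candidate vertex [ib.2], extended by 0 outside [S]. The minus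
   sign matches the side on which optimality bounds the noise. *)
pose b (v : V1) (ib : idx (~: S) * 'I_m.+1) (j : 'I_(4 * m.+1)) : R :=
  if insub j is Some j' then
    - (dist (vertex ib.2) (vertex (v j')) - dist (vertex (a ib.1)) (vertex (v j')))
  else 0.
have := @is_cond_prob_ge _ _ _ P F Fm G _ (1 - 1 / (4 * m.+1)%:R ^+ 2) mG
  (cond_probP P sF Fm mG).
apply=> H FH.
apply: le_trans (@conditional_union_bound _ _ _ P F sF Fm V1 _ X1
  (fun v ib => noise_event E S t (val ib.1) (b v ib)) G
  (expR (- t ^+ 2 / 2)) FX1 _ _ _ mG _ H FH).
(* There are at most n choices of [i] and [m.+1 <= n] candidate vertices. *)
- rewrite lee_wpmul2r// lee_fin lerD2l lerN2 /t union_le_rate//.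
  rewrite card_prod card_ord leq_mul//; last by lia.
  by rewrite card_sig (leq_trans (max_card _)) ?card_ord.
- by move=> v ib; apply: rectangles_generated_measurable; exact: noise_event_outer.
(* Events of [F] see only inner edges, noise events only the complementary ones. *)
- move=> v ib B /Finner FB.
  apply: (@independent_blocks _ _ _ P _ (edge_noise E) (inner_edges S)
    (~: inner_edges S)%SET _ hEindep) => //; last exact: noise_event_outer.
  by move=> e eS; rewrite inE negbK.
- by move=> v ib; apply: noise_event_tail => //; exact: sqrtr_ge0.
move=> w good; rewrite /G /=.
have delta0 : 0 <= d_inf_Pi (coords S xstar) m.+1 by exact: d_inf_Pi_ge0.
apply: bigmax_le => [|i _].
  have C0 : 0 <= C.
    have pcL : 0 <= pi * cL by rewrite mulr_ge0// pi_ge0.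
    apply: addr_ge0; last by rewrite mulr_ge0// pi_ge0.
    by apply: mulr_ge0; [rewrite divr_ge0// ltW|lra].
  apply: mulr_ge0 => //; rewrite !addr_ge0 ?sqrtr_ge0// divr_ge0//.
  by apply: sumr_ge0 => j _; exact: dist_ge0.
rewrite -X2K.
have [_ hmin] := hxhat2 w i.
apply: (@row_estimate R cl cL ce m f Q (idx S) (xstar (val i))
  (fun j => xstar (val j)) (xhat1 (A_SS w)) (fun j => A w (val i) (val j))
  (fun j => sym_noise E (val i) (val j) w) (a i) (X2 w i)) => //.
- by rewrite card_sig.
- move=> j; apply: (@observed_edge _ _ _ P _ E A (fun i j => f (xstar i) (xstar j)) w
    (val i) (val j) hAsym) => //.
    by have [_ fC _ _] := hf => *; exact: fC.
  by apply: contra (outer i) => /eqP ->; exact: valP.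
- exact: aP.
- by rewrite X2K; apply: hmin; apply/C_vertex; exists (a i).
- pose bi := b (X1 w) (i, X2 w i).
  have bE (j : idx S) : bi (val j) = - (dist (vertex (X2 w i)) (xhat1 (A_SS w) j)
      - dist (vertex (a i)) (xhat1 (A_SS w) j)).
    by rewrite /bi /b valK X1K.
  (* The selected vertex [X2 w i] depends on entries outside the block [A_SS]; the union over all
     candidates allows it to be substituted here. *)
  have /negP : ~ noise_event E S t (val i) bi w by exact: good (i, X2 w i).
  rewrite /noise_event /= -leNgt [X in X <= _ -> _]big_sub.
  rewrite [X in _ <= _ * Num.sqrt X -> _]big_sub.
  congr (_ <= _ * Num.sqrt _); apply: eq_bigr => j _; first by rewrite bE.
  by rewrite bE sqrrN.
Qed.
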